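(* Let $K$ be a field, $S=K[x_1,\ldots,x_n]$, $I\subset S$ a monomial ideal, and $\Gamma$ the multicomplex associated with $I$ (the unique multicomplex with $I(\Gamma)=I$). Then the standard pairs with respect to $I$ correspond bijectively to the facets of $\Gamma$. The bijection is established by the assignment $$\operatorname{std}(I)\longrightarrow\mathcal{F}(\Gamma),\quad (u,Z)\mapsto\log u+c(Z).$$
   Context: $\mathbb{N}=\{0,1,2,\dots\}$, $\mathbb{N}_\infty=\mathbb{N}\cup\{\infty\}$, and $\mathbb{N}_\infty^n$ is ordered componentwise. A subset $\Gamma\subset\mathbb{N}_\infty^n$ is a multicomplex if (1) $a\in\Gamma$, $b\in\mathbb{N}_\infty^n$, $b\le a$ imply $b\in\Gamma$; and (2) $\Gamma$ contains the (componentwise) limit of every ascending sequence $a_1\le a_2\le\cdots$ of elements of $\Gamma$. $I(\Gamma)\subset S$ is the monomial ideal spanned by all monomials $x^a$ with $a\in\mathbb{N}^n\setminus\Gamma$; for each monomial ideal $I$ there is a unique multicomplex $\Gamma$ with $I(\Gamma)=I$, namely the smallest multicomplex containing $\{a\in\mathbb{N}^n: x^a\notin I\}$. For $a\in\mathbb{N}_\infty^n$ put $\operatorname{infpt}a=\{i: a(i)=\infty\}$. $\mathcal{M}(\Gamma)$ is the set of maximal elements of $\Gamma$. An element $a\in\Gamma$ is a facet if $\operatorname{infpt}a=\operatorname{infpt}m$ for all $m\in\mathcal{M}(\Gamma)$ with $a\le m$; $\mathcal{F}(\Gamma)$ is the set of facets. For a monomial $u$ let $\operatorname{supp}(u)=\{x_i: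 x_i\mid u\}$. A pair $(u,Z)$ with $u$ a monomial and $Z\subset X=\{x_1,\dots,x_n\}$ is admissible if $\operatorname{supp}(u)\cap Z=\emptyset$. Admissible pairs are partially ordered by $(u,Z)\le(u',Z')$ iff $u$ divides $u'$ and $\operatorname{supp}(u'/u)\cup Z'\subset Z$. An admissible pair $(u,Z)$ is standard with respect to $I$ if $uK[Z]\cap I=\{0\}$ and $(u,Z)$ is minimal (for this order) among admissible pairs with this property; $\operatorname{std}(I)$ is the set of standard pairs. For $u=\prod x_i^{a_i}$, $\log u=(a_1,\dots,a_n)$; $c(Z)\in\mathbb{N}_\infty^n$ has $c(Z)(i)=\infty$ if $x_i\in Z$ and $c(Z)(i)=0$ otherwise. *)

(* Defs.v *)
From HB Require Import structures.
From mathcomp Require Import all_boot all_order all_algebra.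
From mathcomp Require Import boolp classical_sets functions.
From mathcomp Require Import mpoly.

Set Implicit Arguments.
Unset Strict Implicit.
Unset Printing Implicit Defensive.

Import GRing.Theory.

Local Open Scope ring_scope.
Local Open Scope classical_set_scope.

(* N_oo = N U {oo}, with None standing for oo *)
Notation enat := (option nat).

Definition enat_le (x y : enat) : bool :=
  match x, y with
  | _, None => true
  | None, Some _ => false
  | Some p, Some q => (p <= q)%N
  end.

Definition enat_add (x y : enat) : enat :=
  match x, y with
  | Some p, Some q => Some (p + q)%N
  | _, _ => None
  end.

(* convergence of a sequence in N_oo for its usual topology, the one-point
   compactification of the discrete space N *)
Definition enat_lim (x : nat -> enat) (l : enat) : Prop :=
  match l with
  | Some p => exists k0, forall k, (k0 <= k)%N -> x k = Some p
  | None => forall M, exists k0, forall k, (k0 <= k)%N -> enat_le (Some M) (x k)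
  end.

Notation evec n := {ffun 'I_n -> enat}.

Definition evec_le n (a b : evec n) : bool := [forall i, enat_le (a i) (b i)].

Definition evec_add n (a b : evec n) : evec n := [ffun i => enat_add (a i) (b i)].

Definition evec_lim n (a : nat -> evec n) (l : evec n) : Prop :=
  forall i, enat_lim (fun k => a k i) (l i).

(* monomials are represented by their exponents u : 'X_{1..n}, so that this is
   the inclusion of N^n into N_oo^n *)
Definition log n (u : 'X_{1..n}) : evec n := [ffun i => Some (u i)].

Definition cinf n (Z : {set 'I_n}) : evec n :=
  [ffun i => if i \in Z then None else Some 0%N].

Definition infpt n (a : evec n) : {set 'I_n} := [set i | a i == None]%SET.

Definition multicomplex n (Gamma : set (evec n)) : Prop :=
  (forall a b, Gamma a -> evec_le b a -> Gamma b) /\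
  (forall (a : nat -> evec n) (l : evec n),
     (forall k, Gamma (a k)) -> (forall k, evec_le (a k) (a k.+1)) ->
     evec_lim a l -> Gamma l).

Definition maximal_elements n (Gamma : set (evec n)) : set (evec n) :=
  [set m | Gamma m /\ forall b, Gamma b -> evec_le m b -> b = m].

Definition facets n (Gamma : set (evec n)) : set (evec n) :=
  [set a | Gamma a /\
     forall m, maximal_elements Gamma m -> evec_le a m -> infpt a = infpt m].

Section MonomialIdeals.
Variables (K : fieldType) (n : nat).
Implicit Types (A : set 'X_{1..n}) (I : set {mpoly K[n]}).

Definition monomial_span A : set {mpoly K[n]} :=
  [set p | exists s : seq (K * 'X_{1..n}),
     (forall t, t \in s -> A t.2) /\ p = \sum_(t <- s) t.1 *: 'X_[t.2]].

Definition ideal_generated_by_monomials A : set {mpoly K[n]} :=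
  [set p | exists s : seq ({mpoly K[n]} * 'X_{1..n}),
     (forall t, t \in s -> A t.2) /\ p = \sum_(t <- s) t.1 * 'X_[t.2]].

Definition monomial_ideal I : Prop :=
  exists A, I = ideal_generated_by_monomials A.

Definition multicomplex_ideal (Gamma : set (evec n)) : set {mpoly K[n]} :=
  monomial_span [set u | ~ Gamma (log u)].

Definition supp (u : 'X_{1..n}) : {set 'I_n} := [set i | (0 < u i)%N]%SET.

Definition admissible (P : 'X_{1..n} * {set 'I_n}) : Prop :=
  [disjoint supp P.1 & P.2]%B.

(* on exponents, divisibility u | u' is (u <= u')%MM, and the quotient u'/u is
   then (u' - u)%MM *)
Definition pair_le (P Q : 'X_{1..n} * {set 'I_n}) : Prop :=
  (P.1 <= Q.1)%MM /\ (supp (Q.1 - P.1)%MM :|: Q.2)%SET \subset P.2.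

(* the subring K[Z] of polynomials in the variables of Z *)
Definition subring_vars (Z : {set 'I_n}) : set {mpoly K[n]} :=
  [set q | forall m, m \in msupp q -> supp m \subset Z].

Definition avoids_ideal I (P : 'X_{1..n} * {set 'I_n}) : Prop :=
  [set 'X_[K, P.1] * q | q in subring_vars P.2] `&` I = [set 0].

Definition standard_pairs I : set ('X_{1..n} * {set 'I_n}) :=
  [set P | [/\ admissible P, avoids_ideal I P &
     forall Q, admissible Q -> avoids_ideal I Q -> pair_le Q P -> Q = P]].

End MonomialIdeals.

Arguments multicomplex_ideal K {n} Gamma _.

(* Main.v *)
Require Import Defs.
From HB Require Import structures.
From mathcomp Require Import all_boot all_order all_algebra.
From mathcomp Require Import boolp classical_sets functions.
From mathcomp Require Import mpoly.

(* A multicomplex is determined by its finite vectors, so [u K[Z]] meets [I]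
   only in [0] exactly when [log u + c(Z)] lies in [Gamma].  If [(u, Z)] is
   standard and [m] is a maximal element above [log u + c(Z)], then the pair
   [(u', W)], where [W = infpt m] and [u'] is the part of [u] outside [W], is
   below [(u, Z)] and avoids [I]; minimality forces [W = Z].  Conversely, if
   [log u + c(Z)] is a facet and [(u', Z') <= (u, Z)] avoids [I], any maximal
   element above [log u' + c(Z')] has infinite part [Z], so [Z' = Z], and then
   [u' = u] because [supp (u / u')] lies in [Z'] while [supp u] misses [Z]. *)

Set Implicit Arguments.
Unset Strict Implicit.
Unset Printing Implicit Defensive.

Lemma enat_le_refl x : enat_le x x.
Proof. by case: x => //= p. Qed.

Lemma enat_le_trans x y z : enat_le x y -> enat_le y z -> enat_le x z.
Proof. by case: x y z => [p|] [q|] [r|] //=; apply: leq_trans. Qed.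

Lemma enat_le_anti x y : enat_le x y -> enat_le y x -> x = y.
Proof.
by case: x y => [p|] [q|] //= pq qp; congr Some; apply/eqP; rewrite eqn_leq pq.
Qed.

Section Multicomplexes.
Variable n : nat.
Implicit Types (a b : evec n) (Gamma : set (evec n)) (i : 'I_n).

Lemma evec_leP a b : reflect (forall i, enat_le (a i) (b i)) (evec_le a b).
Proof. exact: forallP. Qed.

Lemma evec_le_trans a b c : evec_le a b -> evec_le b c -> evec_le a c.
Proof.
move=> /evec_leP ab /evec_leP bc; apply/evec_leP => i.
exact: enat_le_trans (ab i) (bc i).
Qed.

(** Replacing each infinite coordinate of [a] by [k] gives an ascending sequence of finite vectors
    below [a] with limit [a], so closure under limits applies. *)
Lemma multicomplex_finite Gamma a : multicomplex Gamma ->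
  (forall u : 'X_{1..n}, evec_le (log u) a -> Gamma (log u)) -> Gamma a.
Proof.
move=> [_ lim] fin.
pose trunc k : 'X_{1..n} := [multinom if a i is Some p then p else k | i < n].
apply: (lim (fun k => log (trunc k))) => [k|k|i].
- apply: fin; apply/evec_leP => i; rewrite ffunE mnmE.
  by case: (a i) => [p|] //=.
- apply/evec_leP => i; rewrite !ffunE !mnmE /=.
  by case: (a i) => //= *; exact: leqnn.
- case ai: (a i) => [p|] /=.
    by exists 0 => k _; rewrite ffunE mnmE ai.
  by move=> M; exists M => k Mk; rewrite ffunE mnmE ai.
Qed.

Definition upd a i (t : enat) : evec n := [ffun j => if j == i then t else a j].

Lemma upd_le a b i t : evec_le a b -> enat_le t (b i) -> evec_le (upd a i t) b.
Proof.
by move=> /evec_leP ab tb; apply/evec_leP => j; rewrite ffunE; case: eqP => [->|].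
Qed.

Lemma le_upd a i t : enat_le (a i) t -> evec_le a (upd a i t).
Proof.
move=> at_; apply/evec_leP => j; rewrite ffunE; case: eqP => [->//|_].
exact: enat_le_refl.
Qed.

Lemma coordinate_saturation Gamma a i : multicomplex Gamma -> Gamma a ->
  exists a', [/\ Gamma a', evec_le a a' &
    forall b, Gamma b -> evec_le a' b -> b i = a' i].
Proof.
move=> mG Ga; have [down _] := mG.
have [Goo|nGoo] := pselect (Gamma (upd a i None)).
  exists (upd a i None); split=> // [|b _ /evec_leP/(_ i)].
    by apply: le_upd; case: (a i).
  by rewrite ffunE eqxx; case: (b i).
have [M nGM] : exists M, ~ Gamma (upd a i (Some M)).
  apply: contrapT => /forallNP allG; apply: nGoo.
  apply: multicomplex_finite => // u /evec_leP ua.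
  apply: down (contrapT (allG (u i))) _; apply/evec_leP => j.
  by have := ua j; rewrite !ffunE; case: eqP => [->|_ //] _; exact: leqnn.
case ai: (a i) => [p|]; last first.
  case: nGoo; suff -> : upd a i None = a by [].
  by apply/ffunP => j; rewrite ffunE; case: eqP => [->|].
pose P t := (p <= t) && `[< Gamma (upd a i (Some t)) >].
have exP : exists t, P t.
  exists p; rewrite /P leqnn; apply/asboolP.
  suff -> : upd a i (Some p) = a by [].
  by apply/ffunP => j; rewrite ffunE; case: eqP => [->|].
have ubP t : P t -> t <= M.
  case/andP=> _ /asboolP Gt; rewrite leqNgt; apply/negP => Mt; apply: nGM.
  apply: down Gt _; apply/evec_leP => j; rewrite !ffunE.
  by case: eqP => _; [exact: ltnW | exact: enat_le_refl].
case: (ex_maxnP exP ubP) => t /andP[pt /asboolP Gt] tmax.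
exists (upd a i (Some t)); split=> // [|b Gb tb].
  by apply: le_upd; rewrite ai.
have ab : evec_le a b by apply: evec_le_trans tb; apply: le_upd; rewrite ai.
have := evec_leP _ _ tb i; rewrite !ffunE eqxx.
case bi: (b i) => [q|] /= tq.
  congr Some; apply/eqP; rewrite eqn_leq tq andbT; apply: tmax.
  rewrite /P (leq_trans pt tq); apply/asboolP; apply: down Gb _.
  by apply: upd_le => //; rewrite bi; exact: leqnn.
by case: nGoo; apply: down Gb _; apply: upd_le => //; rewrite bi.
Qed.

(** Coordinates are saturated one at a time. A saturated coordinate stays so under later increases,
    since whatever lies above the new vector lies above the old one. *)
Lemma exists_maximal_above Gamma a : multicomplex Gamma -> Gamma a ->
  exists2 m, maximal_elements Gamma m & evec_le a m.
Proof.
move=> mG Ga.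
suff [m [Gm am satm]] : exists m, [/\ Gamma m, evec_le a m &
    forall i, i \in enum 'I_n -> forall b, Gamma b -> evec_le m b -> b i = m i].
  exists m => //; split=> // b Gb mb; apply/ffunP => i.
  by apply: satm => //; rewrite mem_enum.
elim: (enum 'I_n) => [|i s [m [Gm am satm]]].
  by exists a; split=> //; apply/evec_leP => i; exact: enat_le_refl.
have [m' [Gm' mm' sati]] := coordinate_saturation i mG Gm.
exists m'; split=> // [|j]; first exact: evec_le_trans mm'.
rewrite inE => /orP[/eqP-> //|js] b Gb m'b.
by rewrite (satm j js b Gb (evec_le_trans mm' m'b)) -(satm j js m').
Qed.

End Multicomplexes.

Section StandardPairs.
Variable n : nat.
Implicit Types (P Q : 'X_{1..n} * {set 'I_n}) (u v : 'X_{1..n}) (a : evec n).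

Definition pair_vec P : evec n := evec_add (log P.1) (cinf P.2).

Lemma pair_vecE P i :
  pair_vec P i = if i \in P.2 then None else Some (P.1 i).
Proof. by rewrite !ffunE; case: ifP => //= _; rewrite addn0. Qed.

Lemma infpt_pair_vec P : infpt (pair_vec P) = P.2.
Proof. by apply/setP => i; rewrite inE pair_vecE; case: ifP. Qed.

Lemma admissibleP P : admissible P <-> forall i, i \in P.2 -> P.1 i = 0.
Proof.
split=> [adm i iP2|P0].
  apply/eqP; rewrite -leqn0 leqNgt; apply/negP => lt0.
  by have := disjointFl adm iP2; rewrite inE lt0.
rewrite /admissible disjoint_sym disjoint_subset; apply/fintype.subsetP => i /P0 Pi.
by rewrite !inE Pi.
Qed.

Lemma pair_vec_inj P Q :
  admissible P -> admissible Q -> pair_vec P = pair_vec Q -> P = Q.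
Proof.
move=> /admissibleP aP /admissibleP aQ PQ.
have e2 : P.2 = Q.2 by rewrite -infpt_pair_vec PQ infpt_pair_vec.
rewrite (surjective_pairing P) (surjective_pairing Q); congr pair => //.
apply/mnmP => i; have := congr1 (fun f : evec n => f i) PQ.
rewrite !pair_vecE -e2; case: ifP => [iP _|_ [] //].
by rewrite aP // aQ // -e2.
Qed.

Definition mnm_outside u (W : {set 'I_n}) : 'X_{1..n} :=
  [multinom if i \in W then 0 else u i | i < n].

(** The inverse of [pair_vec] on admissible pairs; the default exponent 0 at infinite coordinates is
    what admissibility demands. *)
Definition vec_pair a : 'X_{1..n} * {set 'I_n} :=
  ([multinom odflt 0 (a i) | i < n], infpt a).

Lemma vec_pair_admissible a : admissible (vec_pair a).
Proof. by apply/admissibleP => i; rewrite inE mnmE => /eqP ->. Qed.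

Lemma vec_pairK a : pair_vec (vec_pair a) = a.
Proof. by apply/ffunP => i; rewrite pair_vecE inE mnmE; case: (a i). Qed.

Local Open Scope ring_scope.
Import GRing.Theory.

Variable K : fieldType.

Lemma msupp_monomial_span (A : set 'X_{1..n}) (p : {mpoly K[n]}) v :
  monomial_span A p -> v \in msupp p -> A v.
Proof.
move=> [s [sA ->]]; rewrite mcoeff_msupp; apply: contra_neqP => nAv.
rewrite raddf_sum big_seq big1 // => t ts /=.
rewrite mcoeffZ mcoeffX; case: eqP => [tv|_]; last by rewrite mulr0.
by case: nAv; rewrite -tv; exact: sA.
Qed.

Lemma avoids_idealP Gamma P : multicomplex Gamma ->
  avoids_ideal (multicomplex_ideal K Gamma) P <-> Gamma (pair_vec P).
Proof.
move=> mG; split=> [av|GP].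
- apply: multicomplex_finite => // v vP; apply: contrapT => nGv.
  (* [w] is the part of [v] in the variables of [P.2], so [P.1 + w] is above [v] and its monomial
     lies in the set that must meet the ideal only in 0. *)
  pose w : 'X_{1..n} := [multinom if i \in P.2 then v i else 0%N | i < n].
  have nGw : ~ Gamma (log (P.1 + w)%MM).
    move=> Gw; apply: nGv; apply: mG.1 Gw _; apply/evec_leP => i.
    have := evec_leP _ _ vP i; rewrite pair_vecE !ffunE mnmDE mnmE /=.
    by case: ifP => _ //= *; [exact: leq_addl | rewrite addn0].
  have : ([set 0]%classic : set {mpoly K[n]}) 'X_[P.1 + w].
    rewrite -av; split.
      exists 'X_[w]; last by rewrite mpolyXD.
      move=> m; rewrite msuppX inE => /eqP ->; apply/fintype.subsetP => i.
      by rewrite inE mnmE; case: ifP.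
    exists [:: (1, (P.1 + w)%MM)]; split; last by rewrite big_seq1 scale1r.
    by move=> t; rewrite inE => /eqP ->.
  by move=> /= /eqP; rewrite -msupp_eq0 msuppX.
- apply/seteqP; split=> [p [[q qZ <-] Ip] /=|p /= ->]; last first.
    split; last by exists [::]; rewrite big_nil; split.
    by exists 0; rewrite ?mulr0 // => m; rewrite msupp0.
  have [->|q0] := eqVneq q 0; first by rewrite mulr0.
  (* One monomial of [q] suffices: its shift by [P.1] occurs in an element of the ideal, yet lies
     below [pair_vec P]. *)
  have mq := mlead_supp q0.
  have /(msupp_monomial_span Ip) : (P.1 + mlead q)%MM \in msupp ('X_[K, P.1] * q).
    by rewrite mcoeff_msupp mulrC mcoeffMX -mcoeff_msupp.
  case; apply: mG.1 GP _; apply/evec_leP => i; rewrite pair_vecE ffunE mnmDE.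
  case: ifP => //= iZ; suff -> : mlead q i = 0%N by rewrite addn0.
  apply/eqP; rewrite -leqn0 leqNgt; apply/negP => lt0.
  by have /fintype.subsetP/(_ i) := qZ _ mq; rewrite inE lt0 iZ => /(_ isT).
Qed.

Lemma standard_pair_facet Gamma P : multicomplex Gamma ->
  standard_pairs (multicomplex_ideal K Gamma) P -> facets Gamma (pair_vec P).
Proof.
move=> mG [/admissibleP aP /avoids_idealP-/(_ mG) GP Pmin]; split=> // m [Gm _] Pm.
pose Q := (mnm_outside P.1 (infpt m), infpt m).
have Pinf : P.2 \subset infpt m.
  apply/fintype.subsetP => i iP; have := evec_leP _ _ Pm i.
  by rewrite pair_vecE iP inE; case: (m i).
suff <- : Q = P by exact: infpt_pair_vec.
apply: Pmin.
- by apply/admissibleP => i /= iW; rewrite mnmE iW.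
- apply/avoids_idealP => //; apply: mG.1 Gm _; apply/evec_leP => i.
  have := evec_leP _ _ Pm i; rewrite !pair_vecE /= mnmE inE.
  by case: (m i) => [p|] //=; case: ifP.
- split; first by apply/mnm_lepP => i; rewrite mnmE; case: ifP.
  rewrite finset.subUset Pinf andbT; apply/fintype.subsetP => i.
  by rewrite inE mnmBE mnmE /=; case: ifP => //; rewrite subnn.
Qed.

Lemma facet_standard_pair Gamma P : multicomplex Gamma -> admissible P ->
  facets Gamma (pair_vec P) -> standard_pairs (multicomplex_ideal K Gamma) P.
Proof.
move=> mG admP [GP facP]; split=> //; first exact/avoids_idealP.
move=> Q admQ /avoids_idealP-/(_ mG) GQ [/mnm_lepP QP].
rewrite finset.subUset => /andP[/fintype.subsetP suppQ subPQ].
have [m maxm Qm] := exists_maximal_above mG GQ.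
(* The pair order reverses the order of vectors: outside [Q.2] the exponents of [P.1] and [Q.1]
   agree. Hence [m] is also above [pair_vec P], and the facet condition applies to it. *)
have PQ : evec_le (pair_vec P) (pair_vec Q).
  apply/evec_leP => i; rewrite !pair_vecE; have := suppQ i.
  rewrite inE mnmBE subn_gt0 ltnNge; case iQ: (i \in Q.2); first by case: ifP.
  by rewrite (contraFF (fintype.subsetP subPQ i) iQ) => /contraFT; apply.
have e2 : Q.2 = P.2.
  apply/eqP; rewrite finset.eqEsubset subPQ andbT -[P.2]infpt_pair_vec.
  rewrite (facP m maxm (evec_le_trans PQ Qm)); apply/fintype.subsetP => i iQ.
  by have := evec_leP _ _ Qm i; rewrite pair_vecE iQ inE; case: (m i).
(* With equal infinite parts, divisibility of [P.1] by [Q.1] gives the inequality opposite to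
   [PQ]. *)
apply: pair_vec_inj => //; apply/ffunP => i; apply: enat_le_anti.
  by rewrite !pair_vecE e2; case: ifP => //= _; exact: QP.
exact: (evec_leP _ _ PQ).
Qed.

End StandardPairs.

Theorem lemma9p14 (K : fieldType) (n : nat) (I : set {mpoly K[n]})
    (Gamma : set (evec n)) :
  monomial_ideal I ->
  multicomplex Gamma ->
  multicomplex_ideal K Gamma = I ->
  set_bij (standard_pairs I) (facets Gamma)
    (fun P => evec_add (log P.1) (cinf P.2)).
Proof.
move=> _ mG <-; split=> [P||a Fa].
- exact: standard_pair_facet.
- by move=> P Q /set_mem[aP _ _] /set_mem[aQ _ _]; exact: pair_vec_inj.
- exists (vec_pair a); last exact: vec_pairK.
  apply: facet_standard_pair => //; first exact: vec_pair_admissible.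
  by rewrite vec_pairK.
Qed.
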